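(* Let $n\ge 1$ be an integer and let $p_1,\dots,p_n\in[0,1]$ be not all zero. Let $d(z,\bar\nu_n(\cdot),\bar\pi_n(\cdot))$ be the minimal distance in probability (defined in the context) between the partial sum process of independent Bernoulli random variables with success probabilities $p_1,\dots,p_n$ and the partial sum process of independent Poisson random variables with means $p_1,\dots,p_n$. Put $$p^*=\max\Bigl\{\max_{i\le n}p_i,\ \sum_{i\le n}p_i^2\Bigr\}.$$ Then for all integers $z\ge 0$ the following hold. (i) If $\sum_{i=1}^n p_i^2\le 1$, then $$d(z,\bar\nu_n(\cdot),\bar\pi_n(\cdot)) < 7\cdot 10^6\,(p^* )^{z+1}\exp\Bigl\{-\tfrac12 z\log\log(z+8)\Bigr\}.$$ (ii) If $\sum_{i=1}^n p_i^2\le 1$, then $$d(z,\bar\nu_n(\cdot),\bar\pi_n(\cdot)) < 10^8\Bigl(\sum_{i=1}^n p_i^2\Bigr)^{(z+2)/2}\exp\Bigl\{-\tfrac18 z\Bigr\}.$$ (iii) If $\sum_{i=1}^n p_i\le \tfrac12$, then $$d(z,\bar\nu_n(\cdot),\bar\pi_n(\cdot)) < 14\sum_{i=1}^n p_i^{z+2}\exp\Bigl\{-\tfrac13 z\Bigr\}.$$ Moreover, (iv) with no restriction on the sums of the $p_i$ or $p_i^2$, $$d(0,\bar\nu_n(\cdot),\bar\pi_n(\cdot))\le \sum_{i=1}^n p_i^2.$$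
   Context: Here $\log$ is the natural logarithm. For $p_1,\dots,p_n$ given, $\nu_1,\dots,\nu_n$ denote independent Bernoulli random variables with $\mathbf P(\nu_i=1)=p_i=1-\mathbf P(\nu_i=0)$, and $\pi_1,\dots,\pi_n$ denote independent Poisson random variables with means $\mathbf E\pi_i=p_i$. The partial sum processes are $\bar\nu_n(k)=\sum_{i\le k}\nu_i$ and $\bar\pi_n(k)=\sum_{i\le k}\pi_i$, $k\le n$. For $z\ge 0$ the minimal distance is $$d(z,\bar\nu_n(\cdot),\bar\pi_n(\cdot))=\inf\ \mathbf P\Bigl(\max_{k\le n}\Bigl|\sum_{i=1}^k(\nu_i-\pi_i)\Bigr|>z\Bigr),$$ where the infimum is over all couplings, i.e. over all pairs of families $\{\nu_i\}_{i\le n}$ and $\{\pi_i\}_{i\le n}$ defined on a common probability space such that $\nu_1,\dots,\nu_n$ are mutually independent with $\nu_i$ Bernoulli with success probability $p_i$ for each $i\le n$, and $\pi_1,\dots,\pi_n$ are mutually independent with $\pi_i$ Poisson with mean $p_i$ for each $i\le n$ (the dependence between the two families being arbitrary). *)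

(* Defs.v *)
From HB Require Import structures.
From mathcomp Require Import all_boot all_order all_algebra.
From mathcomp Require Import all_classical all_reals all_analysis.
Set Implicit Arguments.
Unset Strict Implicit.
Unset Printing Implicit Defensive.
Import Order.TTheory GRing.Theory Num.Theory.
Import numFieldNormedType.Exports.

Local Open Scope classical_set_scope.
Local Open Scope ring_scope.

Definition mutually_independent d d' (T : measurableType d)
    (T' : measurableType d') (R : realType) (P : probability T R)
    (I : finType) (X : I -> {RV P >-> T'}) : Prop :=
  forall (J : {set I}) (A : I -> set T'),
    (forall i, i \in J -> measurable (A i)) ->
    P (\bigcap_(i in [set` J]) X i @^-1` A i) =
    (\prod_(i in J) P (X i @^-1` A i))%E.

(* A Bernoulli variable is bool-valued, true standing for 1 and false for 0.
   The second argument of poisson_prob is a dummy, and poisson_prob 0 _ is the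
   point mass at 0. *)
Definition bernoulli_poisson_coupling (R : realType) (n : nat) (p : 'I_n -> R)
    d (T : measurableType d) (P : probability T R)
    (nu : 'I_n -> {RV P >-> bool}) (pi : 'I_n -> {RV P >-> nat}) : Prop :=
  [/\ mutually_independent nu,
      forall i, distribution P (nu i) =1 bernoulli_prob (p i),
      mutually_independent pi
    & forall i, distribution P (pi i) =1 poisson_prob (p i) 0%N].

(* Indices are shifted by one: k : 'I_n stands for the partial sum of the first
   k.+1 terms. The default value 0 of the maximum is harmless, since the terms
   are nonnegative. *)
Definition max_partial_sum_dist (R : realType) (n : nat) (T : Type)
    (nu : 'I_n -> T -> bool) (pi : 'I_n -> T -> nat) (w : T) : R :=
  \big[Num.max/0]_(k < n)
    `| \sum_(i < n | (i <= k)%N) ((nu i w)%:R - (pi i w)%:R) |.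

(* The infimum is taken in \bar R, where inf set0 = +oo, so that upper bounds
   on it do entail that couplings exist. *)
Definition min_distance (R : realType) (n : nat) (p : 'I_n -> R) (z : R) :
    \bar R :=
  ereal_inf [set x | exists (d : measure_display) (T : measurableType d)
      (P : probability T R)
      (nu : 'I_n -> {RV P >-> bool}) (pi : 'I_n -> {RV P >-> nat}),
    bernoulli_poisson_coupling p nu pi /\
    x = P [set w | z < max_partial_sum_dist R nu pi w]].

Definition pstar (R : realType) (n : nat) (p : 'I_n -> R) : R :=
  Num.max (\big[Num.max/0]_(i < n) p i) (\sum_(i < n) p i ^+ 2).

(* Main.v *)
Require Import Defs.
From HB Require Import structures.
From mathcomp Require Import all_boot all_order all_algebra.
From mathcomp Require Import all_classical all_reals all_analysis.
From mathcomp Require Import measurable_realfun.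
From mathcomp Require Import ring lra.
Set Implicit Arguments.
Unset Strict Implicit.
Unset Printing Implicit Defensive.
Import Order.TTheory GRing.Theory Num.Theory.
Import numFieldNormedType.Exports.

(** All four bounds come from one coupling, in which the pairs (nu_i, pi_i) are
    independent over i.  For a single parameter x, take pi Poisson of mean x
    and an independent bit b, and let nu be 1 as soon as pi > 0 or b = 1, where
    P(b = 1) = 1 - (1 - x) e^x is chosen to make P(nu = 1) = x.  The gap
    |nu - pi| is then at least k >= 1 only if pi >= k + 1, or if k = 1, pi = 0
    and b = 1; hence [coordinate_gap_tail]
      P(|nu - pi| >= k) <= x^(k+1) / (k+1)! + [k = 1] x^2 / 2.

    The maximum over k of the absolute partial sums is at most the sum of the
    gaps D_i, so only P(D_1 + ... + D_n >= z + 1) has to be bounded.  For (iv)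
    the union bound suffices.  For the other three, truncate every D_i at
    m = z + 1: this does not change the event, and makes finitely many tail
    bounds, those with k <= m, enter the exponential moment.  Markov's
    inequality for t^S - 1, rather than t^S, gives [truncated_chernoff]
      P(S >= m) <= (exp(sum_i sum_(1 <= k <= m) t^k b_(i,k)) - 1) / (t^m - 1),
    and the subtracted 1 keeps a factor that is as small as the exponent.

    Suppose that sum_i p_i^(k+1) <= A s^k for 1 <= k <= z + 1.  With t = c / s
    the exponent is at most A K(c), where K(c) = c/2 + (e^c - 1 - c)/c, so that
    the probability is at most 2 (exp(A K(c)) - 1) (s / c)^(z+1) once
    c / s >= 2 [min_distance_le_log_mgf].  The three bounds are three choices:
    - (i) s = p^*, A = 1, c = log(z + 8), so that c^(-z) is exp(-z log log(z+8))
      and half of this absorbs exp(K(c));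
    - (ii) s = A = sqrt(sum_i p_i^2), c = 2;
    - (iii) A = sum_i p_i, c = 3/2 and s^(z+1) = sum_i p_i^(z+2) / A, where the
      moment condition is Lyapunov's inequality for the weights p_i. *)

Local Open Scope ring_scope.
Local Open Scope classical_set_scope.

(** * Poisson tails and the exponential function *)

Section poisson_tail.
Variable R : realType.
Implicit Types x : R.

Lemma fact_mul_le j m : (m`! * j`! <= (m + j)`!)%N.
Proof.
by rewrite -(bin_fact (leq_addr j m)) addKn leq_pmull ?bin_gt0 ?leq_addr.
Qed.

(** Shifting the index by m turns the tail into a sum over all of nat, in which
    (m + j)! >= m! j! leaves the factor x^m / m! and a total mass 1. *)
Lemma poisson_prob_tail x m : 0 <= x ->
  (poisson_prob x 0%N [set k | (m <= k)%N] <= (x ^+ m / m`!%:R)%:E)%E.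
Proof.
move=> x0; rewrite /poisson_prob; case: ltP => [xgt0|xle0]; last first.
  have -> : x = 0 by apply/le_anti; rewrite x0 xle0.
  case: m => [|m].
    by rewrite expr0 fact0 divr1 diracE lee_fin; case: (_ \in _).
  by rewrite diracE memNset// expr0n mul0r lee_fin.
have -> : [set k | (m <= k)%N] = [set (m + j)%N | j in [set: nat]].
  apply/seteqP; split => [k /= mk|k [j _ <-]/=]; last exact: leq_addr.
  by exists (k - m)%N => //; rewrite subnKC.
have pmf_ge0 k : (0 <= (poisson_pmf x k)%:E)%E.
  by rewrite lee_fin poisson_pmf_ge0.
have c0 : 0 <= x ^+ m / m`!%:R by rewrite divr_ge0 ?exprn_ge0.
rewrite esum_image; last by move=> i j _ _ /addnI.
apply: (@le_trans _ _ (\esum_(j in [set: nat])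
    ((x ^+ m / m`!%:R)%:E * (poisson_pmf x j)%:E)%E)).
  apply: le_esum => j _; rewrite -EFinM lee_fin /poisson_pmf xgt0.
  rewrite exprD mulrA ler_wpM2r ?expR_ge0//.
  rewrite -mulrA [leRHS]mulrACA mulrA ler_wpM2l ?mulr_ge0 ?exprn_ge0//.
  rewrite -invfM -natrM lef_pV2 ?posrE ?ltr0n ?muln_gt0 ?fact_gt0//.
  by rewrite ler_nat fact_mul_le.
rewrite -nneseries_esumT; last by move=> j; rewrite mule_ge0// lee_fin.
rewrite nneseriesZl// nneseries_esumT//.
have -> : \esum_(i in [set: nat]) (poisson_pmf x i)%:E = 1%E.
  have : poisson_prob x 0%N setT = 1%E by exact: probability_setT.
  by rewrite /poisson_prob xgt0.
by rewrite mule1.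
Qed.

Lemma poisson_prob0 x : 0 <= x ->
  poisson_prob x 0%N [set 0%N] = (expR (- x))%:E.
Proof.
move=> x0; rewrite /poisson_prob; case: ltP => [xgt0|xle0]; last first.
  have -> : x = 0 by apply/le_anti; rewrite x0 xle0.
  by rewrite diracE mem_set// oppr0 expR0.
rewrite esum_set1 ?lee_fin ?poisson_pmf_ge0// /poisson_pmf xgt0.
by rewrite expr0 fact0 invr1 !mul1r.
Qed.

End poisson_tail.

Section exponential_bounds.
Variable R : realType.
Implicit Types x : R.

Lemma exp_partial_sum_le x N : 0 <= x ->
  \sum_(0 <= k < N) x ^+ k / k`!%:R <= expR x.
Proof.
move=> x0; apply: (nondecreasing_cvgn_le _ (is_cvg_series_exp_coeff x) N).
apply/nondecreasing_seqP => k; rewrite /series/= big_nat_recr//=.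
by rewrite lerDl exp_coeff_ge0.
Qed.

(** The reciprocal of 1 + x + x^2/2 is at most 1 - x + x^2/2, because the
    product of the two is 1 + x^4/4. *)
Lemma expRN_le_quadratic x : 0 <= x -> expR (- x) <= 1 - x + x ^+ 2 / 2.
Proof.
move=> x0; rewrite expRN -[leRHS]invrK lef_pV2 ?posrE ?expR_gt0//; last first.
  by rewrite invr_gt0; nra.
apply: le_trans (exp_partial_sum_le 3 x0); rewrite !big_nat_recr//= big_nil.
rewrite expr0 expr1 (_ : 2`!%:R = 2)// !divr1 add0r.
by rewrite -div1r ler_pdivrMr; nra.
Qed.

Lemma expR_sub1_le (x : R) : expR x - 1 <= x * expR x.
Proof.
have := expR_ge1Dx (- x); rewrite expRN => h.
have := expR_gt0 x; rewrite -(@ler_pM2r _ (expR x)) in h; last exact: expR_gt0.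
by rewrite mulVf ?gt_eqF ?expR_gt0// mulrDl in h; lra.
Qed.

(** Rational upper bounds for exp, from 1 - 1/16 <= exp(-1/16). *)
Lemma expR_div16_le j : expR (j%:R / 16) <= (16 / 15) ^+ j :> R.
Proof.
have e0 : 0 < expR 16^-1 :> R by exact: expR_gt0.
rewrite expRM_natl; apply: lerXn2r; rewrite ?nnegrE ?expR_ge0//.
have : (1 - 16^-1) * expR 16^-1 <= 1 :> R.
  by rewrite -ler_pdivlMr// div1r -expRN; exact: expR_ge1Dx.
by lra.
Qed.

Lemma expR_nat_le j : expR j%:R <= 3 ^+ j :> R.
Proof.
rewrite -[j%:R]mulr1 expRM_natl; apply: lerXn2r; rewrite ?nnegrE ?expR_ge0//.
by have := expR_div16_le 16; rewrite divff//; lra.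
Qed.

Lemma exprn_le_expR (r a : R) z : 0 <= r -> r <= expR (- a) ->
  r ^+ z <= expR (- (a * z%:R)).
Proof.
move=> r0 ra; rewrite -mulNr expRM_natr; apply: lerXn2r => //.
exact: expR_ge0.
Qed.

End exponential_bounds.

(** * Independent families *)

Section independent_family.
Variable R : realType.

Section product_probability.
Context d1 d2 (T1 : measurableType d1) (T2 : measurableType d2).
Variables (P1 : probability T1 R) (P2 : probability T2 R).

Definition prod_prob : set (T1 * T2) -> \bar R := (P1 \x P2)%E.

HB.instance Definition _ := Measure.on prod_prob.

Let prod_prob_setT : prod_prob setT = 1%E.
Proof.
rewrite -setXTT; transitivity (P1 setT * P2 setT)%E.
  exact: product_measure1E.
by rewrite !probability_setT mule1.
Qed.

HB.instance Definition _ :=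
  Measure_isProbability.Build _ _ _ prod_prob prod_prob_setT.

Lemma prod_probE A1 A2 : measurable A1 -> measurable A2 ->
  prod_prob (A1 `*` A2) = (P1 A1 * P2 A2)%E.
Proof. exact: product_measure1E. Qed.

End product_probability.

Context d (E : measurableType d).

(** The n-fold product is built by induction: the new coordinate is the left
    factor of a binary product with the space already constructed.  The product
    rule over all indices contains the one over any subfamily, since the
    remaining sets can be taken to be the whole space. *)
Lemma exists_product_family n (mu : 'I_n -> probability E R) :
  exists d' (T : measurableType d') (P : probability T R) (X : 'I_n -> T -> E),
    (forall i, measurable_fun setT (X i)) /\
    forall A : 'I_n -> set E, (forall i, measurable (A i)) ->
      P (\bigcap_i (X i @^-1` A i)) = (\prod_i mu i (A i))%E.
Proof.
elim: n mu => [|n IHn] mu.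
  exists _, unit, (dirac tt), (fun _ _ => point); split => [[]//|A _].
  rewrite big_ord0 (_ : \bigcap_i _ = setT) ?probability_setT//.
  by apply/seteqP; split => // w _ [].
have [d' [T [P [X [mX PX]]]]] := IHn (fun i => mu (lift ord0 i)).
pose Y i : E * T -> E := if unlift ord0 i is Some j then X j \o snd else fst.
exists _, (E * T)%type, (prod_prob (mu ord0) P), Y; split => [i|A mA].
  by rewrite /Y; case: unliftP => [j _|_] //; exact: measurableT_comp.
rewrite big_ord_recl -PX//.
rewrite -(prod_probE (mu ord0) P)//; last first.
  apply: fin_bigcap_measurable => // i _.
  by rewrite -[X in measurable X]setTI; exact: mX.
congr (prod_prob _ _ _); apply/seteqP; split => [w Yw|w [Y0 Yw] i _]/=.
  split => [|j _]; first by have := Yw ord0 I; rewrite /Y/= unlift_none.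
  by have := Yw (lift ord0 j) I; rewrite /Y/= liftK.
rewrite /Y; case: unliftP => [j ->|->] //=; exact: Yw.
Qed.

End independent_family.

Section independence.
Variable R : realType.

Lemma exists_independent_family d (E : measurableType d) n
    (mu : 'I_n -> probability E R) :
  exists d' (T : measurableType d') (P : probability T R)
      (X : 'I_n -> {RV P >-> E}),
    mutually_independent X /\
    forall i A, measurable A -> P (X i @^-1` A) = mu i A.
Proof.
have [d' [T [P [X [mX PX]]]]] := exists_product_family mu.
have PXJ (J : {set 'I_n}) (A : 'I_n -> set E) :
    (forall i, i \in J -> measurable (A i)) ->
    P (\bigcap_(i in [set` J]) (X i @^-1` A i)) = (\prod_(i in J) mu i (A i))%E.
  move=> mA; pose B i := if i \in J then A i else setT.
  have -> : \bigcap_(i in [set` J]) (X i @^-1` A i) =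
            \bigcap_i (X i @^-1` B i).
    rewrite [LHS]bigcap_mkcond; apply: eq_bigcapr => i _.
    by rewrite /B mem_setE; case: ifP.
  rewrite PX; last by move=> i; rewrite /B; case: ifP => // /mA.
  rewrite [RHS]big_mkcond; apply: eq_bigr => i _.
  by rewrite /B; case: ifP; rewrite ?probability_setT.
have PX1 i A : measurable A -> P (X i @^-1` A) = mu i A.
  move=> mA; have := PXJ [set i]%SET (fun=> A) (fun _ _ => mA).
  rewrite big_set1 => <-; congr (P _); apply/seteqP; split => [w Xw j|w]/=.
    by rewrite inE => /eqP ->.
  by apply => /=; rewrite set11.
exists d', T, P, (fun i => mfun_Sub (mem_set (mX i))); split=> // J A mA.
rewrite PXJ//; apply: eq_bigr => i iJ; rewrite -PX1//; exact: mA.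
Qed.

Lemma mutually_independent_comp d d' d'' (T : measurableType d)
    (T' : measurableType d') (T'' : measurableType d'') (P : probability T R)
    (I : finType) (X : I -> {RV P >-> T'}) (g : I -> {mfun T' >-> T''}) :
  mutually_independent X ->
  mutually_independent (fun i => g i \o X i : {RV P >-> T''}).
Proof.
move=> indX J A mA; rewrite -(indX J (fun i => g i @^-1` A i))// => i iJ.
by rewrite -[X in measurable X]setTI; apply: measurable_funPT => //; exact: mA.
Qed.

Lemma probability_bigsetU_le d (T : measurableType d) (P : probability T R)
    (I : finType) (Q : pred I) (A : I -> set T) :
  (forall i, measurable (A i)) ->
  (P (\big[setU/set0]_(i | Q i) A i) <= \sum_(i | Q i) P (A i))%E.
Proof.
move=> mA.
suff: measurable (\big[setU/set0]_(i | Q i) A i) /\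
    (P (\big[setU/set0]_(i | Q i) A i) <= \sum_(i | Q i) P (A i))%E by case.
elim/big_ind2 : _ => [|B x C y [mB PB] [mC PC]|//].
  by rewrite measure0.
split; first exact: measurableU.
by apply: (le_trans (measureU2 _ mB mC)); exact: leeD.
Qed.

(** * An exponential tail bound for truncated sums *)

Section truncated_chernoff.
Context d (T : measurableType d) (P : probability T R) (n : nat)
  (D : 'I_n -> {RV P >-> nat}).

Lemma measurable_preimage_nat i (A : set nat) : measurable (D i @^-1` A).
Proof. by rewrite -[X in measurable X]setTI; exact: measurable_funPT. Qed.

Lemma measurable_sum_tail m : measurable [set w | (m <= \sum_(i < n) D i w)%N].
Proof.
have mfS : measurable_fun setT (fun w => (\sum_(i < n) D i w)%N).
  have : forall s, measurable_fun setT (fun w => (\sum_(i <- s) D i w)%N).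
    elim=> [|i s IH].
      by under eq_fun do rewrite big_nil; exact: measurable_cst.
    under eq_fun do rewrite big_cons; exact: measurable_fun_addn.
  exact.
rewrite -[X in measurable X]setTI.
exact: (mfS measurableT [set k | (m <= k)%N]).
Qed.

Hypothesis indD : mutually_independent D.

Variable m : nat.

Let cell (f : {ffun 'I_n -> 'I_m.+1}) : set T :=
  \bigcap_(i in [set` [set: 'I_n]%SET])
    (D i @^-1` [set k | minn m k = f i]).

Let mcell f : measurable (cell f).
Proof.
by apply: fin_bigcap_measurable => // i _; exact: measurable_preimage_nat.
Qed.

Let q i (k : 'I_m.+1) := fine (P (D i @^-1` [set l | minn m l = k])).

Let Pcell f : P (cell f) = (\prod_i q i (f i))%:E.
Proof.
rewrite /cell indD// -prodEFin big_mkcond; apply: eq_bigr => i _.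
rewrite finset.in_setT.
by rewrite /q fineK// fin_num_measure//; exact: measurable_preimage_nat.
Qed.

Let q_ge0 i k : 0 <= q i k. Proof. by rewrite fine_ge0. Qed.

Let q_le1 i k : q i k <= 1.
Proof.
have mA := measurable_preimage_nat i [set l | minn m l = k].
by rewrite -lee_fin fineK ?fin_num_measure// probability_le1.
Qed.

Let cover_cells (Q : pred {ffun 'I_n -> 'I_m.+1}) (B : set T) : measurable B ->
  (forall w (f : {ffun 'I_n -> 'I_m.+1}), B w ->
    (forall i, minn m (D i w) = f i) -> Q f) ->
  (P B <= (\sum_(f | Q f) \prod_i q i (f i))%:E)%E.
Proof.
move=> mB BQ; rewrite -sumEFin; under eq_bigr do rewrite -Pcell.
apply: le_trans (probability_bigsetU_le P Q mcell).
apply: le_measure; rewrite ?inE//.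
  by apply: bigsetU_measurable => f _.
move=> w Bw; pose f := [ffun i => inord (minn m (D i w)) : 'I_m.+1].
have fE i : minn m (D i w) = f i by rewrite ffunE inordK// ltnS geq_minl.
rewrite -bigcup_seq_cond.
by exists f; [rewrite /= mem_index_enum; exact: BQ fE|move=> i _ /=].
Qed.

(** Truncating the variables at m does not affect whether their sum reaches m,
    and leaves finitely many joint values f, of probability w f.  On those with
    sum >= m, the ratio (t^(sum f) - 1) / (t^m - 1) is at least 1, and
    sum_f w f t^(sum f) factors over the coordinates by independence.
    Subadditivity of P is enough to compare: it also gives sum_f w f >= 1. *)
Lemma truncated_chernoff (t : R) (b : 'I_n -> nat -> R) : (0 < m)%N -> 1 < t ->
  (forall i k, (0 < k <= m)%N ->
    (P (D i @^-1` [set l | (k <= l)%N]) <= (b i k)%:E)%E) ->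
  (P [set w | (m <= \sum_(i < n) D i w)%N] <=
   ((expR (\sum_(i < n) \sum_(1 <= k < m.+1) t ^+ k * b i k) - 1) /
    (t ^+ m - 1))%:E)%E.
Proof.
move=> m0 t1 Db.
have tm1 : 0 < t ^+ m - 1 by rewrite subr_gt0 exprn_egt1// -lt0n.
pose Q (f : {ffun 'I_n -> 'I_m.+1}) := (m <= \sum_i f i)%N.
pose w (f : {ffun 'I_n -> 'I_m.+1}) := \prod_i q i (f i).
have w_ge0 f : 0 <= w f by apply: prodr_ge0 => i _.
have total_ge1 : 1 <= \sum_f w f.
  rewrite -lee_fin -(probability_setT P).
  exact: (cover_cells (Q := xpredT) measurableT).
have mS := measurable_sum_tail m.
apply: (le_trans (cover_cells (Q := Q) mS _)).
  move=> x f /= mD fE; rewrite /Q; under eq_bigr do rewrite -fE.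
  have [[i mi]|Dm] := pselect (exists i, (m <= D i x)%N).
    by rewrite (bigD1 i)//= (minn_idPl mi) leq_addr.
  under eq_bigr => i _.
    rewrite (minn_idPr _); first by over.
    by rewrite leqNgt; apply/negP => /ltnW mi; apply: Dm; exists i.
  by [].
rewrite lee_fin ler_pdivlMr//.
apply: (@le_trans _ _ (\sum_f w f * (t ^+ (\sum_i f i) - 1))).
  rewrite mulr_suml [leRHS](bigID Q)/=.
  apply: ler_wpDr.
    by apply: sumr_ge0 => f _; rewrite mulr_ge0// subr_ge0 exprn_ege1// ltW.
  apply: ler_sum => f mf; apply: ler_wpM2l; first exact: w_ge0.
  by rewrite lerD2r ler_weXn2l// ltW.
under eq_bigr do rewrite mulrBr mulr1.
rewrite sumrB lerB//.
have -> : \sum_f w f * t ^+ (\sum_i f i) =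
    \prod_(i < n) \sum_(k < m.+1) q i k * t ^+ k.
  rewrite bigA_distr_bigA; apply: eq_bigr => f _.
  by rewrite big_split -expr_sum.
rewrite expR_sum; apply: ler_prod => i _; apply/andP; split.
  by apply: sumr_ge0 => k _; rewrite mulr_ge0// exprn_ge0// ltW// (lt_trans _ t1).
(* The probability of the value 0 is bounded by 1, that of k > 0 by the tail
   bound b i k. *)
apply: le_trans (expR_ge1Dx _).
rewrite big_ord_recl expr0 mulr1 lerD// big_add1 big_mkord.
apply: ler_sum => k _; rewrite mulrC lift0; apply: ler_wpM2l.
  by rewrite exprn_ge0// ltW// (lt_trans _ t1).
have km : (0 < k.+1 <= m)%N by rewrite /= ltn_ord.
rewrite -lee_fin; apply: le_trans (Db i k.+1 km).
rewrite fineK; last by rewrite fin_num_measure//; exact: measurable_preimage_nat.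
apply: le_measure; rewrite ?inE//; [exact: measurable_preimage_nat..|].
by move=> x /=; rewrite -[bump 0 k]/k.+1 => <-; exact: geq_minr.
Qed.

End truncated_chernoff.
End independence.

(** * The coupling *)

Section coordinate_coupling.
Variable R : realType.
Implicit Types x : R.

(** A point w of nat * bool is a pair (pi, b) of a Poisson value and an extra
    bit; the Bernoulli variable is a function of this pair. *)
Definition coupled_bernoulli (w : nat * bool) : bool := (0 < w.1)%N || w.2.

Definition coupling_gap (w : nat * bool) : nat :=
  if w.1 is k.+1 then k else w.2.

Lemma coupling_gapE w :
  `| (coupled_bernoulli w)%:R - w.1%:R | = (coupling_gap w)%:R :> R.
Proof.
case: w => -[|k] b; rewrite /coupled_bernoulli /coupling_gap /=.
  by rewrite subr0 ger0_norm.
by rewrite distrC -natr1 addrK ger0_norm.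
Qed.

Lemma measurable_nat_bool (A : set (nat * bool)) : measurable A.
Proof.
rewrite (_ : A = \bigcup_k ([set k] `*` [set b | A (k, b)])).
  by apply: bigcupT_measurable => k; exact: measurableX.
by apply/seteqP; split => [[k b] Akb|[k b] [_ _ [/= -> ]]//]; exists k.
Qed.

Definition mfun_nat_bool d (E : measurableType d) (f : nat * bool -> E) :
    {mfun (nat * bool)%type >-> E} :=
  mfun_Sub (mem_set (fun _ A _ => measurable_nat_bool (setT `&` f @^-1` A))).

(** The solution q of exp(-x) (1 - q) = 1 - x: the Bernoulli variable vanishes
    exactly when the Poisson variable and the extra bit do. *)
Definition extra_success x := 1 - (1 - x) * expR x.

Lemma extra_success01 x : 0 <= x <= 1 -> 0 <= extra_success x <= 1.
Proof.
case/andP => x0 x1; rewrite /extra_success lerBlDr lerDl subr_ge0.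
rewrite mulr_ge0 ?expR_ge0 ?subr_ge0// andbT.
by rewrite -ler_pdivlMr ?expR_gt0// div1r -expRN; exact: expR_ge1Dx.
Qed.

Definition coordinate_prob x : probability (nat * bool)%type R :=
  prod_prob (poisson_prob x 0%N) (bernoulli_prob (extra_success x)).

Lemma coordinate_probX x A B : coordinate_prob x (A `*` B) =
  (poisson_prob x 0%N A * bernoulli_prob (extra_success x) B)%E.
Proof. exact: prod_probE. Qed.

Lemma coordinate_prob_poisson x A :
  coordinate_prob x (fst @^-1` A) = poisson_prob x 0%N A.
Proof.
rewrite -setXT coordinate_probX.
by rewrite (probability_setT (bernoulli_prob _)) mule1.
Qed.

Lemma coordinate_prob_bernoulli x : 0 <= x <= 1 ->
  coordinate_prob x (coupled_bernoulli @^-1` [set true]) = x%:E.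
Proof.
move=> x01; have x0 : 0 <= x by case/andP: x01.
rewrite (_ : _ @^-1` _ = ~` ([set 0%N] `*` [set false])); last first.
  apply/seteqP; split => [[[|k] [|]]|[[|k] [|]]]//=.
  - by move=> _ [].
  - by move=> _ [].
  - by move=> _ [].
  - by move=> [].
rewrite probability_setC; last exact: measurable_nat_bool.
rewrite coordinate_probX.
rewrite poisson_prob0// bernoulli_probE ?extra_success01//.
rewrite !diracE memNset// mem_set// mule0 add0e mule1 -EFinM -EFinB.
congr (_%:E); rewrite -[X in _ - _ * X]/(1 - extra_success x).
by rewrite /extra_success subKr mulrCA -expRD addNr expR0 mulr1 subKr.
Qed.

Definition gap_tail_bound x k : R :=
  x ^+ k.+1 / k.+1`!%:R + (x ^+ 2 / 2) *+ (k == 1)%N.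

(** A gap of at least k > 0 needs a Poisson value above k, or k = 1 and the pair
    (0, true), whose probability is exp(-x) - 1 + x. *)
Lemma coordinate_gap_tail x k : 0 <= x <= 1 -> (0 < k)%N ->
  (coordinate_prob x (coupling_gap @^-1` [set l | (k <= l)%N]) <=
   (gap_tail_bound x k)%:E)%E.
Proof.
move=> x01 k0; have x0 : 0 <= x by case/andP: x01.
pose A : set (nat * bool) :=
  if k == 1%N then [set 0%N] `*` [set true] else set0.
apply: (@le_trans _ _ (coordinate_prob x
    (fst @^-1` [set l | (k.+1 <= l)%N] `|` A))).
  apply: le_measure; rewrite ?inE; [exact: measurable_nat_bool..|].
  case=> [[|l] b]; rewrite /coupling_gap/= => kl; last by left.
  by right; rewrite /A; case: b kl; case: k k0 {A} => [|[|k]].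
have poisson_part : (coordinate_prob x (fst @^-1` [set l | (k.+1 <= l)%N]) <=
    (x ^+ k.+1 / k.+1`!%:R)%:E)%E.
  by rewrite coordinate_prob_poisson; exact: poisson_prob_tail.
have extra_part : (coordinate_prob x A <= ((x ^+ 2 / 2) *+ (k == 1)%N)%:E)%E.
  rewrite /A; case: ifP => _; last by rewrite measure0.
  rewrite coordinate_probX poisson_prob0// bernoulli_probE ?extra_success01//.
  rewrite !diracE mem_set// memNset// mule0 adde0 mule1 -EFinM lee_fin.
  rewrite /extra_success mulrBr mulr1 mulrCA -expRD addNr expR0 mulr1.
  by have := expRN_le_quadratic x0; rewrite mulr1n; lra.
apply: (le_trans (measureU2 _ _ _)); [exact: measurable_nat_bool..|].
by rewrite EFinD; exact: leeD.
Qed.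

End coordinate_coupling.

Section coupling.
Variables (R : realType) (n : nat) (p : 'I_n -> R).
Hypothesis p01 : forall i, 0 <= p i <= 1.

Lemma measurable_max_partial_sum_dist d (T : measurableType d)
    (P : probability T R) (nu : 'I_n -> {RV P >-> bool})
    (pi : 'I_n -> {RV P >-> nat}) :
  measurable_fun setT (max_partial_sum_dist R nu pi).
Proof.
rewrite /max_partial_sum_dist.
have mS (k : 'I_n) : measurable_fun setT
    (fun w => `| \sum_(i < n | (i <= k)%N) ((nu i w)%:R - (pi i w)%:R) | : R).
  apply: measurableT_comp => //; rewrite /=.
  under eq_fun => w do rewrite big_mkcond.
  apply: measurable_sum => i; case: (i <= k)%N; last exact: measurable_cst.
  apply: measurable_funB.
    exact: (measurableT_comp (f := fun b : bool => b%:R : R)).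
  exact: (measurableT_comp (f := fun k : nat => k%:R : R)).
have mM (s : seq 'I_n) : measurable_fun setT (fun w => \big[Num.max/0]_(k <- s)
    `| \sum_(i < n | (i <= k)%N) ((nu i w)%:R - (pi i w)%:R) | : R).
  elim: s => [|k s IH].
    by under eq_fun do rewrite big_nil; exact: measurable_cst.
  by under eq_fun do rewrite big_cons; exact: measurable_maxr.
exact: mM.
Qed.

Lemma max_partial_sum_dist_le T (nu : 'I_n -> T -> bool)
    (pi : 'I_n -> T -> nat) w :
  max_partial_sum_dist R nu pi w <=
  \sum_(i < n) `| (nu i w)%:R - (pi i w)%:R |.
Proof.
apply/bigmax_leP; split => [|k _]; first by apply: sumr_ge0.
apply: (le_trans (ler_norm_sum _ _ _)).
by rewrite [leLHS]big_mkcond; apply: ler_sum => i _; case: ifP.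
Qed.

Lemma exists_coupling : exists d (T : measurableType d) (P : probability T R)
    (nu : 'I_n -> {RV P >-> bool}) (pi D : 'I_n -> {RV P >-> nat}),
  [/\ bernoulli_poisson_coupling p nu pi, mutually_independent D,
      forall i k, (0 < k)%N ->
        (P (D i @^-1` [set l | (k <= l)%N]) <= (gap_tail_bound (p i) k)%:E)%E
    & forall w, max_partial_sum_dist R nu pi w <= (\sum_(i < n) D i w)%:R].
Proof.
have [d [T [P [X [indX PX]]]]] :=
  exists_independent_family (fun i => coordinate_prob (p i)).
pose nu i : {RV P >-> bool} := mfun_nat_bool coupled_bernoulli \o X i.
pose pi i : {RV P >-> nat} := mfun_nat_bool fst \o X i.
pose D i : {RV P >-> nat} := mfun_nat_bool coupling_gap \o X i.
exists d, T, P, nu, pi, D; split.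
- split.
  + exact: (mutually_independent_comp (fun=> mfun_nat_bool coupled_bernoulli)).
  + move=> i; apply: eq_bernoulli.
    rewrite -[RHS](coordinate_prob_bernoulli (p01 i)) -PX//.
    exact: measurable_nat_bool.
  + exact: (mutually_independent_comp (fun=> mfun_nat_bool fst)).
  + move=> i A; rewrite -coordinate_prob_poisson -PX//.
    exact: measurable_nat_bool.
- exact: (mutually_independent_comp (fun=> mfun_nat_bool coupling_gap)).
- move=> i k k0; apply: le_trans (coordinate_gap_tail (p01 i) k0).
  by rewrite -PX//; exact: measurable_nat_bool.
- move=> w; apply: (le_trans (max_partial_sum_dist_le _ _ _)).
  by rewrite natr_sum; apply: ler_sum => i _; rewrite coupling_gapE.
Qed.

Lemma min_distance_le_tail z : exists d (T : measurableType d)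
    (P : probability T R) (D : 'I_n -> {RV P >-> nat}),
  [/\ mutually_independent D,
      forall i k, (0 < k)%N ->
        (P (D i @^-1` [set l | (k <= l)%N]) <= (gap_tail_bound (p i) k)%:E)%E
    & (min_distance p z%:R <= P [set w | (z < \sum_(i < n) D i w)%N])%E].
Proof.
have [d [T [P [nu [pi [D [cpl indD tailD leD]]]]]]] := exists_coupling.
exists d, T, P, D; split => //.
apply: (@le_trans _ _ (P [set w | z%:R < max_partial_sum_dist R nu pi w])).
  by apply: ereal_inf_lbound; exists d, T, P, nu, pi.
apply: le_measure; rewrite ?inE.
- have := measurable_max_partial_sum_dist nu pi measurableT
    (measurable_itv (Interval (BRight z%:R) +oo%O)).
  rewrite setTI; congr (measurable _); apply/seteqP.
  by split => w /=; rewrite in_itv/= andbT.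
- exact: measurable_sum_tail.
- by move=> w /= /lt_le_trans /(_ (leD w)); rewrite ltr_nat.
Qed.

Lemma min_distance_le_chernoff (z : nat) (t : R) : 1 < t ->
  (min_distance p z%:R <=
   ((expR (\sum_(i < n) \sum_(1 <= k < z.+2)
            t ^+ k * gap_tail_bound (p i) k) - 1) /
    (t ^+ z.+1 - 1))%:E)%E.
Proof.
move=> t1; have [d [T [P [D [indD tailD dD]]]]] := min_distance_le_tail z.
apply: (le_trans dD); apply: truncated_chernoff => // i k /andP[k0 _].
exact: tailD.
Qed.

Lemma min_distance0_le : (min_distance p 0 <= (\sum_(i < n) p i ^+ 2)%:E)%E.
Proof.
have [d [T [P [D [indD tailD dD]]]]] := min_distance_le_tail 0.
apply: (le_trans dD).
apply: (@le_trans _ _ (P (\big[setU/set0]_(i < n)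
    (D i @^-1` [set l | (1 <= l)%N])))).
  apply: le_measure; rewrite ?inE; first exact: measurable_sum_tail.
    by apply: bigsetU_measurable => i _; exact: measurable_preimage_nat.
  move=> w /=; rewrite lt0n sum_nat_eq0 negb_forall => /existsP[i Di].
  by rewrite -bigcup_seq; exists i; rewrite /= ?mem_index_enum// lt0n.
apply: le_trans (probability_bigsetU_le _ _ _) _.
  by move=> i; exact: measurable_preimage_nat.
rewrite -sumEFin; apply: lee_sum => i _.
apply: (le_trans (tailD i 1%N _)) => //.
by rewrite lee_fin /gap_tail_bound mulr1n (_ : 2`!%:R = 2)//; lra.
Qed.

End coupling.

(** * The bound in terms of power sums of the parameters *)

Section moment_bounds.
Variable R : realType.

(** The function K of the opening comment: a bound on the logarithm of the
    moment generating function of the gaps, per unit of A, at t = c / s. *)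
Definition gap_log_mgf (c : R) : R := c / 2 + (expR c - 1 - c) / c.

Lemma gap_log_mgf_ge0 (c : R) : 0 <= c -> 0 <= gap_log_mgf c.
Proof.
move=> c0; rewrite addr_ge0// divr_ge0// -addrA -opprD subr_ge0.
exact: expR_ge1Dx.
Qed.

Lemma sum_shifted_exp_le (c : R) N : 0 < c ->
  \sum_(1 <= k < N.+1) c ^+ k / k.+1`!%:R <= (expR c - 1 - c) / c.
Proof.
move=> c0; rewrite ler_pdivlMr// lerBrDr lerBrDr.
apply: le_trans (exp_partial_sum_le N.+2 (ltW c0)).
rewrite [leRHS]big_nat_recl// big_nat_recl//= expr0 expr1 !divr1.
rewrite addrC lerD2l addrC lerD2l big_add1/= mulr_suml.
by apply: ler_sum => k _; rewrite [c ^+ k.+2]exprSr mulrAC.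
Qed.

Variables (n : nat) (p : 'I_n -> R).
Hypothesis p01 : forall i, 0 <= p i <= 1.

(** Exchanging the two sums leaves (c/s)^k sum_i p_i^(k+1) <= A c^k for each k,
    so that the main terms add up to A times a part of the series of
    (e^c - 1 - c)/c; the extra bits contribute at most A c/2. *)
Lemma sum_gap_tail_bound_le m (A s c : R) : 0 <= A -> 0 < s -> 0 < c ->
  (forall k, (0 < k <= m)%N -> \sum_(i < n) p i ^+ k.+1 <= A * s ^+ k) ->
  \sum_(i < n) \sum_(1 <= k < m.+1) (c / s) ^+ k * gap_tail_bound (p i) k <=
  A * gap_log_mgf c.
Proof.
move=> A0 s0 c0 moment.
rewrite exchange_big/=.
apply: (@le_trans _ _ (\sum_(1 <= k < m.+1)
    (A * (c ^+ k / k.+1`!%:R) + (A * c / 2) *+ (k == 1)%N))).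
  apply: ler_sum_nat => k km.
  have cs0 : 0 <= (c / s) ^+ k by rewrite exprn_ge0// divr_ge0// ltW.
  have csk : (c / s) ^+ k * (\sum_(i < n) p i ^+ k.+1) <= A * c ^+ k.
    apply: (le_trans (ler_wpM2l cs0 (moment k km))).
    by rewrite mulrCA -exprMn divfK// gt_eqF.
  rewrite -mulr_sumr big_split/= -mulr_suml mulrDr !mulrA; apply: lerD.
    by rewrite ler_wpM2r.
  case: eqP => [k1|_]; last by rewrite big1// mulr0.
  under eq_bigr do rewrite mulr1n.
  rewrite -mulr_suml mulr1n mulrA ler_wpM2r//.
  by move: csk; rewrite k1 !expr1.
rewrite big_split/= -mulr_sumr mulrDr addrC lerD//; last first.
  by rewrite ler_wpM2l// sum_shifted_exp_le.
case: m {moment} => [|m]; first by rewrite big_geq// mulr_ge0// divr_ge0// ltW.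
rewrite big_ltn//= mulr1n big_nat_cond big1 ?addr0 -?mulrA//.
by move=> k /andP[/andP[k2 _] _]; rewrite gtn_eqF.
Qed.

(** The condition c / s >= 2 serves to replace t^(z+1) - 1 by t^(z+1) / 2. *)
Lemma min_distance_le_log_mgf (z : nat) (A s c : R) :
  0 <= A -> 0 < s -> 0 < c -> 2 <= c / s ->
  (forall k, (0 < k <= z.+1)%N -> \sum_(i < n) p i ^+ k.+1 <= A * s ^+ k) ->
  (min_distance p z%:R <=
   (2 * (expR (A * gap_log_mgf c) - 1) * (s / c) ^+ z.+1)%:E)%E.
Proof.
move=> A0 s0 c0 cs2 moment.
have cs1 : 1 < c / s by apply: lt_le_trans cs2; lra.
apply: (le_trans (min_distance_le_chernoff p01 z cs1)); rewrite lee_fin.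
have T2 : 2 <= (c / s) ^+ z.+1.
  by apply: (le_trans cs2); rewrite exprS ler_peMr ?exprn_ege1 ?ltW//; lra.
rewrite -(invf_div c s) exprVn.
rewrite ler_pdivrMr; last lra.
set u := (c / s) ^+ z.+1 in T2 *.
have E1 : expR (\sum_(i < n) \sum_(1 <= k < z.+2)
    (c / s) ^+ k * gap_tail_bound (p i) k) <= expR (A * gap_log_mgf c).
  by rewrite ler_expR; exact: sum_gap_tail_bound_le.
apply: (@le_trans _ _ (expR (A * gap_log_mgf c) - 1)); first by rewrite lerD2r.
have E0 : 0 <= expR (A * gap_log_mgf c) - 1.
  by rewrite subr_ge0 -expR0 ler_expR mulr_ge0// gap_log_mgf_ge0// ltW.
have u2 : u^-1 <= 2^-1 by rewrite lef_pV2 ?posrE//; lra.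
have -> : 2 * (expR (A * gap_log_mgf c) - 1) * u^-1 * (u - 1) =
    2 * (expR (A * gap_log_mgf c) - 1) * (1 - u^-1).
  by field; rewrite gt_eqF//; lra.
by nra.
Qed.

End moment_bounds.

(** * Inequalities between power sums *)

Section power_sums.
Variable R : realType.
Implicit Types x : R.

Lemma sum_expS_le (n : nat) (p : 'I_n -> R) (r : R) k :
  (forall i, 0 <= p i <= r) ->
  \sum_(i < n) p i ^+ k.+2 <= (\sum_(i < n) p i ^+ 2) * r ^+ k.
Proof.
move=> pr; rewrite mulr_suml; apply: ler_sum => i _.
have /andP[p0 pler] := pr i.
rewrite -addn2 addnC exprD ler_wpM2l ?exprn_ge0//.
by rewrite lerXn2r// nnegrE (le_trans p0).
Qed.

(** Factor x - 1 out of both sides: each power x^l with l < k lies on the same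
    side of x^m as 1 does of x. *)
Lemma geometric_tangent x k m : 0 <= x -> (k <= m.+1)%N ->
  x ^+ k - 1 <= k%:R * x ^+ m * (x - 1).
Proof.
move=> x0 km; rewrite subrX1 mulrC -[k in k%:R]card_ord -sumr_const.
rewrite [in leRHS]mulr_suml !mulr_suml; apply: ler_sum => l _; rewrite mul1r.
have lm : (l <= m)%N by rewrite -ltnS (leq_trans _ km).
have [x1|x1] := leP 1 x.
  by rewrite ler_wpM2r ?subr_ge0// ler_weXn2l.
by rewrite ler_wnM2r ?subr_le0 ?ler_wiXn2l// ltW.
Qed.

(** Young's inequality x^k <= (k/m) x^m + (1 - k/m) with m = k + j, in the form
    without denominators. *)
Lemma young_pow x k j : 0 <= x ->
  (k + j)%:R * x ^+ k <= k%:R * x ^+ (k + j) + j%:R.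
Proof.
move=> x0; elim: j => [|j IH]; first by rewrite addn0 addr0.
have := @geometric_tangent x k (k + j) x0 (leq_trans (leq_addr j k) (leqnSn _)).
by move: IH; rewrite addnS -!natr1 exprS; nra.
Qed.

(** Apply Young's inequality to x = p i / s and average with the weights p i:
    the choice of s makes the average of (p i / s)^m equal to 1. *)
Lemma lyapunov (n : nat) (p : 'I_n -> R) (s : R) k m :
  (forall i, 0 <= p i) -> 0 < s -> (0 < m)%N -> (k <= m)%N ->
  \sum_(i < n) p i ^+ m.+1 = (\sum_(i < n) p i) * s ^+ m ->
  \sum_(i < n) p i ^+ k.+1 <= (\sum_(i < n) p i) * s ^+ k.
Proof.
move=> p0 s0 m0 km defs.
have sk0 j : 0 < s ^+ j by rewrite exprn_gt0.
have pE j i : p i ^+ j.+1 = s ^+ j * (p i * (p i / s) ^+ j).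
  by rewrite expr_div_n exprS; field; rewrite gt_eqF.
have normalized : \sum_(i < n) p i * (p i / s) ^+ m = \sum_(i < n) p i.
  apply: (mulfI (lt0r_neq0 (sk0 m))); rewrite mulr_sumr [RHS]mulrC -defs.
  by apply: eq_bigr => i _; rewrite pE.
under eq_bigr do rewrite pE.
rewrite -mulr_sumr mulrC; apply: ler_wpM2r; first exact: ltW.
have m0R : 0 < m%:R :> R by rewrite ltr0n.
rewrite -(ler_pM2l m0R) -[leRHS](_ : \sum_(i < n) p i *
    (k%:R * (p i / s) ^+ m + (m - k)%:R) = _); last first.
  under eq_bigr do rewrite mulrDr mulrCA.
  rewrite big_split/= -mulr_sumr normalized -mulr_suml -[_ * (m - k)%:R]mulrC.
  by rewrite -mulrDl -natrD subnKC.
rewrite mulr_sumr; apply: ler_sum => i _; rewrite mulrCA ler_wpM2l//.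
have ps0 : 0 <= p i / s by rewrite divr_ge0// ltW.
by have := young_pow k (m - k) ps0; rewrite subnKC.
Qed.

End power_sums.

(** * The bounds *)

Section three_bounds.
Variables (R : realType) (n : nat) (p : 'I_n -> R).
Hypothesis p01 : forall i, 0 <= p i <= 1.
Hypothesis p_neq0 : exists i, p i != 0.

Let p_ge0 i : 0 <= p i. Proof. by case/andP: (p01 i). Qed.

Lemma sum_exp_gt0 k : 0 < \sum_(i < n) p i ^+ k.
Proof.
have [i pi0] := p_neq0; rewrite (bigD1 i)//= ltr_pwDl//.
  by rewrite exprn_gt0// lt_def pi0 p_ge0.
by apply: sumr_ge0 => j _; rewrite exprn_ge0.
Qed.

(** At c = log(z + 8) the bound K(c) is of order z / log z, below half of
    z log log z up to a constant.  The elementary estimates log c >= 1 - 1/c and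
    c <= (z + 8)/16 + 3 suffice, with 1/c <= 1/2 for z <= 30 and c >= 16/5
    beyond. *)
Lemma gap_log_mgf_ln_le (z : nat) : let c := ln (z%:R + 8) : R in
  2 <= c /\ gap_log_mgf c <= 1 / 2 * z%:R * ln c + 13.
Proof.
move=> c; have z0 : 0 <= z%:R :> R by [].
have z8 : 0 < z%:R + 8 :> R by lra.
have ec : expR c = z%:R + 8 by rewrite lnK// posrE.
have cge j : (16 / 15) ^+ j <= z%:R + 8 :> R -> j%:R / 16 <= c.
  by move=> h; rewrite -ler_expR ec; apply: le_trans h; exact: expR_div16_le.
have c2 : 2 <= c by have := cge 32%N; lra.
split=> //; have c0 : 0 < c by lra.
have lnc : 1 - c^-1 <= ln c.
  have := @le_ln1Dx R (c^-1 - 1); rewrite subrKC lnV ?posrE//.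
  by have := invr_gt0 c; rewrite c0 => h; lra.
(* The tangent of the logarithm at 16. *)
have cle : c <= (z%:R + 8) / 16 + 3.
  have := @le_ln1Dx R ((z%:R + 8) / 16 - 1); rewrite subrKC.
  rewrite ln_div ?posrE// -/c => h.
  have : ln 16 <= 4 :> R.
    rewrite (_ : 16 = 2 ^+ 4) ?lnXn//; last by rewrite -natrX.
    have : ln (1 + 1) <= 1 :> R by apply: le_ln1Dx; lra.
    by rewrite -[1 + 1]/(2 : R); lra.
  lra.
rewrite /gap_log_mgf ec.
have -> : c / 2 + (z%:R + 8 - 1 - c) / c = c / 2 + (z%:R + 7) * c^-1 - 1.
  by field; rewrite gt_eqF.
have ic : c^-1 <= 2^-1 by rewrite lef_pV2 ?posrE//.
have ic0 : 0 < c^-1 by rewrite invr_gt0.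
have key : 3 / 2 * z%:R * c^-1 <= 15 / 32 * z%:R + 17 / 2.
  have [z29|z30] := leP (z%:R : R) 30; first by nra.
  have c16 : 16 / 5 <= c by have := cge 52%N; lra.
  have : c^-1 <= (16 / 5)^-1 by rewrite lef_pV2 ?posrE//; lra.
  nra.
have : z%:R * (1 - c^-1) <= z%:R * ln c by exact: ler_wpM2l.
nra.
Qed.

Lemma min_distance_lt_pstar (z : nat) : \sum_(i < n) p i ^+ 2 <= 1 ->
  (min_distance p z%:R <
    (7 * 10 ^+ 6 * pstar p ^+ (z + 1) *
     expR (- (1 / 2 * z%:R * ln (ln (z%:R + 8)))))%:E)%E.
Proof.
move=> S1; set c := ln (z%:R + 8); set s := pstar p.
have [c2 mgf_c] := gap_log_mgf_ln_le z; rewrite -/c in c2 mgf_c.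
have c0 : 0 < c by lra.
have S_le : \sum_(i < n) p i ^+ 2 <= s by rewrite le_max lexx orbT.
have s0 : 0 < s := lt_le_trans (sum_exp_gt0 2) S_le.
have s1 : s <= 1.
  rewrite ge_max S1 andbT; apply/bigmax_leP; split=> // i _.
  by case/andP: (p01 i).
have ps i : 0 <= p i <= s by rewrite p_ge0 le_max le_bigmax.
have cs2 : 2 <= c / s by rewrite ler_pdivlMr//; nra.
have moment k : (0 < k <= z.+1)%N -> \sum_(i < n) p i ^+ k.+1 <= 1 * s ^+ k.
  case: k => // k _; apply: (le_trans (sum_expS_le k ps)).
  by rewrite mul1r exprS ler_wpM2r// exprn_ge0// ltW.
apply: (le_lt_trans (min_distance_le_log_mgf p01 ler01 s0 c0 cs2 moment)).
rewrite lte_fin (mul1r (gap_log_mgf c)) addn1 expr_div_n.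
set L := ln c; set u := s ^+ z.+1.
have u0 : 0 < u by rewrite exprn_gt0.
have c_inv : (c ^+ z.+1)^-1 <= expR (- (z%:R * L)).
  rewrite expRN expRM_natl lnK ?posrE// lef_pV2 ?posrE ?exprn_gt0//.
  by rewrite exprS ler_peMl ?exprn_ge0 ?(ltW c0)//; lra.
(* Half of the decay of c^(-z) pays for exp(K(c)), and 2 * 3^13 < 7 * 10^6. *)
have mgf_exp : expR (gap_log_mgf c) <= expR (1 / 2 * z%:R * L) * 3 ^+ 13.
  apply: le_trans (ler_wpM2l (expR_ge0 _) (expR_nat_le R 13)).
  by rewrite -expRD ler_expR.
apply: (@lt_le_trans _ _ (2 * expR (gap_log_mgf c) * (u / c ^+ z.+1))).
  have uc0 : 0 < u / c ^+ z.+1 by rewrite divr_gt0// exprn_gt0.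
  by rewrite ltr_pM2r//; lra.
set E := expR (- (1 / 2 * z%:R * L)).
have product_le : expR (gap_log_mgf c) * (c ^+ z.+1)^-1 <= 3 ^+ 13 * E.
  have -> : E = expR (1 / 2 * z%:R * L) * expR (- (z%:R * L)).
    by rewrite -expRD; congr expR; lra.
  rewrite mulrA [3 ^+ 13 * _]mulrC; apply: ler_pM => //.
  by rewrite invr_ge0 exprn_ge0// ltW.
have uE0 : 0 <= u * E by rewrite mulr_ge0 ?expR_ge0// ltW.
have := ler_wpM2l (ltW u0) product_le.
by rewrite !exprS expr0; lra.
Qed.

Lemma min_distance_lt_sum_sqr (z : nat) : \sum_(i < n) p i ^+ 2 <= 1 ->
  (min_distance p z%:R <
    (10 ^+ 8 * (\sum_(i < n) p i ^+ 2) `^ ((z%:R + 2) / 2) *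
     expR (- (1 / 8 * z%:R)))%:E)%E.
Proof.
move=> S1; set S := \sum_(i < n) _ in S1 *.
have S0 : 0 < S := sum_exp_gt0 2.
pose s := Num.sqrt S.
have s0 : 0 < s by rewrite sqrtr_gt0.
have sS : s ^+ 2 = S by rewrite sqr_sqrtr// ltW.
have s1 : s <= 1 by rewrite -sqrtr1 ler_sqrt.
have ps i : 0 <= p i <= s.
  rewrite p_ge0 -[leLHS]ger0_norm// -sqrtr_sqr ler_sqrt ?(ltW S0)//.
  rewrite /S (bigD1 i)//= lerDl.
  by apply: sumr_ge0 => j _; rewrite exprn_ge0.
have moment k : (0 < k <= z.+1)%N -> \sum_(i < n) p i ^+ k.+1 <= s * s ^+ k.
  case: k => // k _; apply: (le_trans (sum_expS_le k ps)).
  by rewrite -/S -sS -exprD -exprS.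
have c0 : 0 < 2 :> R by [].
have cs2 : 2 <= 2 / s by rewrite ler_pdivlMr//; lra.
apply: (le_lt_trans (min_distance_le_log_mgf p01 (ltW s0) s0 c0 cs2 moment)).
have -> : S `^ ((z%:R + 2) / 2) = s * s ^+ z.+1.
  rewrite mulrC powRrM powR12_sqrt ?(ltW S0)// -/s -natrD addn2.
  by rewrite powR_mulrn ?(ltW s0)// exprS.
rewrite lte_fin expr_div_n; set u := s ^+ z.+1.
have u0 : 0 < u by rewrite exprn_gt0.
have mgf0 : 0 <= gap_log_mgf (2 : R) by exact: gap_log_mgf_ge0.
have mgf4 : gap_log_mgf (2 : R) <= 4.
  by have := expR_nat_le R 2; rewrite /gap_log_mgf; lra.
have exp81 : expR (s * gap_log_mgf 2) <= 81.
  have : expR (s * gap_log_mgf 2) <= expR 4%:R by rewrite ler_expR; nra.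
  by have := expR_nat_le R 4; rewrite !exprS expr0; lra.
have exp_ge1 : 0 <= expR (s * gap_log_mgf 2) - 1.
  have := expR_ge1Dx (s * gap_log_mgf 2); have := mulr_ge0 (ltW s0) mgf0; lra.
(* This is where the exponent z + 2 in place of z + 1 comes from. *)
have exp_sub1 : expR (s * gap_log_mgf 2) - 1 <= s * 324.
  apply: (le_trans (expR_sub1_le _)); rewrite -mulrA ler_wpM2l ?(ltW s0)//.
  by rewrite (_ : 324 = 4 * 81); [rewrite ler_pM ?expR_ge0|ring].
set E := expR (- (1 / 8 * z%:R)).
have E0 : 0 < E by exact: expR_gt0.
have two_pow : (2 ^+ z.+1)^-1 <= E.
  apply: le_trans (_ : (2^-1) ^+ z <= _).
    rewrite exprVn lef_pV2 ?posrE ?exprn_gt0// exprS ler_peMl ?exprn_ge0//; lra.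
  apply: exprn_le_expR => //; rewrite expRN lef_pV2 ?posrE ?expR_gt0//.
  rewrite (_ : 1 / 8 = 2%:R / 16); last by lra.
  by apply: (le_trans (expR_div16_le R 2)); lra.
have usE : 0 < s * u * E by rewrite !mulr_gt0.
apply: (@le_lt_trans _ _ (2 * (s * 324) * (u * E))).
  apply: ler_pM.
  - exact: mulr_ge0.
  - by rewrite divr_ge0 ?exprn_ge0// ltW.
  - by rewrite ler_wpM2l.
  - by rewrite ler_wpM2l// ltW.
by rewrite !exprS expr0; lra.
Qed.

Lemma min_distance_lt_sum_exp (z : nat) : \sum_(i < n) p i <= 1 / 2 ->
  (min_distance p z%:R <
    (14 * (\sum_(i < n) p i ^+ (z + 2)) * expR (- (1 / 3 * z%:R)))%:E)%E.
Proof.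
rewrite addn2; set M := \sum_(i < n) p i => M2; set N := \sum_(i < n) _.
have M0 : 0 < M by have := sum_exp_gt0 1; under eq_bigr do rewrite expr1.
have N0 : 0 < N := sum_exp_gt0 _.
(* The norm of p in L^(z+1) for the weights p_i normalized by M. *)
pose s := (N / M) `^ (z.+1%:R^-1).
have s0 : 0 < s by rewrite powR_gt0// divr_gt0.
have sz : s ^+ z.+1 = N / M.
  rewrite -powR_mulrn ?(ltW s0)// -powRrM mulVf ?pnatr_eq0// powRr1//.
  by rewrite divr_ge0// ltW.
have ps i : 0 <= p i <= 1 / 2.
  rewrite p_ge0 (le_trans _ M2)// /M (bigD1 i)//= lerDl.
  by apply: sumr_ge0 => j _.
have s2 : s <= 1 / 2.
  rewrite -(@ler_pXn2r _ z.+1)// ?nnegrE ?(ltW s0)//.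
  rewrite sz ler_pdivrMr// /N /M mulr_sumr; apply: ler_sum => i _.
  rewrite exprSr ler_wpM2r// lerXn2r// ?nnegrE//.
  by case/andP: (ps i).
have moment k : (0 < k <= z.+1)%N -> \sum_(i < n) p i ^+ k.+1 <= M * s ^+ k.
  move=> /andP[_ kz]; apply: (@lyapunov _ _ _ _ _ z.+1) => //.
  by rewrite -/M sz mulrC divfK ?gt_eqF.
pose c : R := 3 / 2.
have c0 : 0 < c by rewrite /c; lra.
have cs2 : 2 <= c / s by rewrite ler_pdivlMr// /c; lra.
apply: (le_lt_trans (min_distance_le_log_mgf p01 (ltW M0) s0 c0 cs2 moment)).
rewrite lte_fin expr_div_n sz.
have mgf0 : 0 <= gap_log_mgf c by apply: gap_log_mgf_ge0; exact: ltW.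
have mgf_le : gap_log_mgf c <= 9 / 4.
  have := expR_div16_le R 24; rewrite (_ : 24 / 16 = c); last by rewrite /c; lra.
  by rewrite /gap_log_mgf !exprS expr0 => ?; rewrite /c; lra.
have exp_le : expR (M * gap_log_mgf c) <= 16 / 5.
  have : expR (M * gap_log_mgf c) <= expR (18%:R / 16) by rewrite ler_expR; nra.
  by have := expR_div16_le R 18; rewrite !exprS expr0; lra.
have exp_ge1 : 0 <= expR (M * gap_log_mgf c) - 1.
  have := expR_ge1Dx (M * gap_log_mgf c); have := mulr_ge0 (ltW M0) mgf0; lra.
(* The factor M gained here cancels the denominator of s^(z+1) = N / M. *)
have exp_sub1 : expR (M * gap_log_mgf c) - 1 <= M * (36 / 5).
  apply: (le_trans (expR_sub1_le _)); rewrite -mulrA ler_wpM2l ?(ltW M0)//.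
  by rewrite (_ : 36 / 5 = 9 / 4 * (16 / 5)); [rewrite ler_pM ?expR_ge0|lra].
set E := expR (- (1 / 3 * z%:R)).
have E0 : 0 < E by exact: expR_gt0.
have c_pow : (c ^+ z.+1)^-1 <= 2 / 3 * E.
  rewrite exprS invfM (_ : c^-1 = 2 / 3); last by rewrite /c; field.
  apply: ler_wpM2l; first by lra.
  rewrite -exprVn; apply: exprn_le_expR; first by rewrite invr_ge0 ltW.
  rewrite expRN lef_pV2 ?posrE ?expR_gt0//.
  rewrite -(@ler_pXn2r _ 3)// ?nnegrE ?expR_ge0 ?ltW//.
  rewrite -expRM_natr (_ : 1 / 3 * 3 = 1%:R); last by lra.
  by have := expR_nat_le R 1; rewrite /c !exprS expr0; lra.
have NE : 0 < N * E by rewrite mulr_gt0.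
apply: (@le_lt_trans _ _ (2 * (M * (36 / 5)) * (N / M * (2 / 3 * E)))).
  apply: ler_pM.
  - exact: mulr_ge0.
  - by rewrite !divr_ge0 ?exprn_ge0// ltW.
  - by rewrite ler_wpM2l.
  - by rewrite ler_wpM2l// divr_ge0// ltW.
have -> : 2 * (M * (36 / 5)) * (N / M * (2 / 3 * E)) = 48 / 5 * (N * E).
  by field; rewrite gt_eqF.
lra.
Qed.

End three_bounds.

Theorem theorem2 (R : realType) (n : nat) (p : 'I_n -> R)
    (n_ge1 : (1 <= n)%N)
    (p01 : forall i, 0 <= p i <= 1)
    (p_neq0 : exists i, p i != 0) :
  (forall z : nat,
    [/\ \sum_(i < n) p i ^+ 2 <= 1 ->
        (min_distance p z%:R <
          (7 * 10 ^+ 6 * pstar p ^+ (z + 1) *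
           expR (- (1 / 2 * z%:R * ln (ln (z%:R + 8)))))%:E)%E,
        \sum_(i < n) p i ^+ 2 <= 1 ->
        (min_distance p z%:R <
          (10 ^+ 8 * (\sum_(i < n) p i ^+ 2) `^ ((z%:R + 2) / 2) *
           expR (- (1 / 8 * z%:R)))%:E)%E
      & \sum_(i < n) p i <= 1 / 2 ->
        (min_distance p z%:R <
          (14 * (\sum_(i < n) p i ^+ (z + 2)) *
           expR (- (1 / 3 * z%:R)))%:E)%E]) /\
  (min_distance p 0 <= (\sum_(i < n) p i ^+ 2)%:E)%E.
Proof.
split; last exact: min_distance0_le.
move=> z; split.
- exact: min_distance_lt_pstar.
- exact: min_distance_lt_sum_sqr.
- exact: min_distance_lt_sum_exp.
Qed.
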